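(* Let $\mathbb{A}\in\{\mathbb{R},\mathbb{C},\mathbb{H},\mathbb{O}\}$ and let $n\ge 1$, with $n=1$ when $\mathbb{A}=\mathbb{O}$. Let $H_{\mathbb{A}}(n)$ be the group of special twisted isomorphisms of $\mathbb{A}^n$. Then $$H_{\mathbb{R}}(n)=SO(n),\qquad H_{\mathbb{C}}(n)=SU(n),\qquad H_{\mathbb{H}}(n)=Sp(n),\qquad H_{\mathbb{O}}(1)=G_2 .$$
   Context: $\mathbb{R},\mathbb{C},\mathbb{H},\mathbb{O}$ are the four normed division algebras with their standard inner products; $\mathbb{A}^n$ (with $n=1$ if $\mathbb{A}=\mathbb{O}$) carries the standard Euclidean inner product and componentwise right multiplication by elements of $\mathbb{A}$. A twisted isomorphism of $\mathbb{A}^n$ is an $\mathbb{R}$-linear isometry $\phi$ of $\mathbb{A}^n$ such that there exists $\theta\in SO(\mathbb{A})$ with $\phi(vx)=\phi(v)\theta(x)$ for all $v\in\mathbb{A}^n$, $x\in\mathbb{A}$. The group of twisted isomorphisms is denoted $G_{\mathbb{A}}(n)$; it is $O(n)$, $U(n)$, $Sp(n)Sp(1)$ (maps $v\mapsto\alpha(v)\beta$ with $\alpha\in Sp(n)$ right $\mathbb{H}$-linear isometry, $\beta$ a unit quaternion), $Spin(7)\subset SO(8)$ for $\mathbb{A}=\mathbb{R},\mathbb{C},\mathbb{H},\mathbb{O}$ respectively. An action $\lambda_{\mathbb{A}}$ of $G_{\mathbb{A}}(n)$ on $\mathbb{A}$ is given, for $g\in G_{\mathbb{A}}(n)$ and $x\in\mathbb{A}$,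 by: $\lambda_{\mathbb{R}}(g)(x)=x\det(g)$; $\lambda_{\mathbb{C}}(g)(x)=x\det_{\mathbb{C}}(g)$; $\lambda_{\mathbb{H}}(g)(x)=x\beta$ where $g=(\alpha,\beta)\in Sp(n)Sp(1)$ (since $(\alpha,\beta)$ and $(-\alpha,-\beta)$ define the same $g$, this is defined only up to sign, i.e. projectively); $\lambda_{\mathbb{O}}(g)(x)=g\cdot x$ via $Spin(7)\subset SO(8)=SO(\mathbb{O})$. A twisted isomorphism $g\in G_{\mathbb{A}}(n)$ is called special if $\lambda_{\mathbb{A}}(g)$ fixes $1\in\mathbb{A}$ (for $\mathbb{A}=\mathbb{H}$: fixes $1$ up to sign, i.e. $\beta=\pm1$). $H_{\mathbb{A}}(n)\subset G_{\mathbb{A}}(n)$ is the group of special twisted isomorphisms. $G_2$ is the automorphism group of the algebra $\mathbb{O}$. *)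

(* Defs.v *)
From HB Require Import structures.
From mathcomp Require Import all_boot all_order all_algebra.
From mathcomp Require Import complex.
From mathcomp Require Import classical_sets reals.

Set Implicit Arguments.
Unset Strict Implicit.
Unset Printing Implicit Defensive.

Import Order.TTheory GRing.Theory Num.Theory.
Local Open Scope classical_set_scope.
Local Open Scope ring_scope.

(** The library has no non-associative algebras, so an algebra is given by
    its underlying real vector space together with its structure maps.  Only
    the four values [algR], [algC], [algH], [algO] below are used. *)
Record alg (R : realType) := Alg {
  car :> lmodType R ;
  amul : car -> car -> car ;
  aone : car ;
  aconj : car -> car ;
  aip : car -> car -> R ;
  (* the standard basis, orthonormal for [aip] *)
  abasis : seq car }.

Arguments amul {R A} : rename.
Arguments aone {R A} : rename.
Arguments aconj {R A} : rename.
Arguments aip {R A} : rename.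
Arguments abasis {R} A : rename.

Definition algR (R : realType) : alg R :=
  @Alg R R^o (fun x y => x * y) 1 id (fun x y => x * y) [:: 1].

(** [Rcomplex R] is [R[i]] regarded as a vector space over [R]
    ([R[i]] itself is a vector space over [R[i]]). *)
Definition algC (R : realType) : alg R :=
  @Alg R (Rcomplex R) (fun x y => (x : R[i]) * y) (1 : R[i]) (@conjc R)
    (fun x y => complex.Re x * complex.Re y + complex.Im x * complex.Im y)
    [:: Complex 1 0; Complex 0 1].

(** Cayley-Dickson doubling.  The product [amul] is not the componentwise
    product that the library puts on pairs. *)
Definition double (R : realType) (A : alg R) : alg R :=
  @Alg R (A * A)%type
    (fun x y => (amul x.1 y.1 - amul (aconj y.2) x.2,
                 amul y.2 x.1 + amul x.2 (aconj y.1)))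
    (aone, 0)
    (fun x => (aconj x.1, - x.2))
    (fun x y => aip x.1 y.1 + aip x.2 y.2)
    ([seq (e, 0) | e <- abasis A] ++ [seq (0, e) | e <- abasis A]).

Definition algH (R : realType) : alg R := double (algC R).
Definition algO (R : realType) : alg R := double (algH R).

Section Twisted.
Variables (R : realType) (A : alg R).

Definition linear_isometry (V : lmodType R) (ip : V -> V -> R) (f : V -> V) :=
  linear f /\ forall v w, ip (f v) (f w) = ip v w.

(** The matrix of [f] in the standard orthonormal basis. *)
Definition endo_mx (f : A -> A) : 'M[R]_(size (abasis A)) :=
  \matrix_(i, j) aip (nth 0 (abasis A) i) (f (nth 0 (abasis A) j)).

Definition SOalg : set (A -> A) :=
  [set f | linear_isometry (@aip R A) f /\ \det (endo_mx f) = 1].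

Variable n : nat.

Definition space : lmodType R := {ffun 'I_n -> A}.

Definition ip_space (v w : space) : R := \sum_i aip (v i) (w i).

Definition rscale (v : space) (x : A) : space := [ffun i => amul (v i) x].

Definition std_vec (j : 'I_n) : space := [ffun i => if i == j then aone else 0].

Definition twisted_iso : set (space -> space) :=
  [set phi | linear_isometry ip_space phi /\
     exists2 theta : A -> A, SOalg theta &
       forall v x, phi (rscale v x) = rscale (phi v) (theta x)].

End Twisted.

Section Lambda.
Variable R : realType.

(** Determinants of the matrix of [g] in the standard basis over R, resp. over
    C.  No linearity is required of [g]; these are the usual determinants when
    [g] is R-linear, resp. C-linear, as every twisted isomorphism is. *)
Definition detR n (g : space (algR R) n -> space (algR R) n) : R :=
  \det (\matrix_(i, j) g (std_vec (algR R) j) i).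

Definition detC n (g : space (algC R) n -> space (algC R) n) : R[i] :=
  \det (\matrix_(i, j) (g (std_vec (algC R) j) i : R[i])).

Definition Sp n : set (space (algH R) n -> space (algH R) n) :=
  [set a | linear_isometry (@ip_space R (algH R) n) a /\
     forall v x, a (rscale v x) = rscale (a v) x].

Definition represents n (alpha : space (algH R) n -> space (algH R) n)
    (beta : algH R) (g : space (algH R) n -> space (algH R) n) :=
  [/\ Sp alpha, aip beta beta = 1 & forall v, g v = rscale (alpha v) beta].

Definition lambdaR n (g : space (algR R) n -> space (algR R) n)
    (x : algR R) : algR R := amul x (detR g).

Definition lambdaC n (g : space (algC R) n -> space (algC R) n)
    (x : algC R) : algC R := amul x (detC g).

(** The action on H is only projective: its value is the set of all x beta
    such that some pair (alpha, beta) represents g, i.e. a class modulo sign. *)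
Definition lambdaH n (g : space (algH R) n -> space (algH R) n)
    (x : algH R) : set (algH R) :=
  [set y | exists alpha beta, represents alpha beta g /\ y = amul x beta].

Definition sign_class (x : algH R) : set (algH R) := [set x; - x].

(** Via Spin(7) in SO(8) = SO(O), [g] acts on O itself, where O^1 is
    identified with O by [v |-> v ord0]. *)
Definition lambdaO (g : space (algO R) 1 -> space (algO R) 1)
    (x : algO R) : algO R := g [ffun=> x] ord0.

Definition HR n : set (space (algR R) n -> space (algR R) n) :=
  [set g | twisted_iso g /\ lambdaR g aone = aone].

Definition HC n : set (space (algC R) n -> space (algC R) n) :=
  [set g | twisted_iso g /\ lambdaC g aone = aone].

Definition HH n : set (space (algH R) n -> space (algH R) n) :=
  [set g | twisted_iso g /\ lambdaH g aone = sign_class aone].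

Definition HO : set (space (algO R) 1 -> space (algO R) 1) :=
  [set g | twisted_iso g /\ lambdaO g aone = aone].

Definition actR n (M : 'M[R]_n) (v : space (algR R) n) : space (algR R) n :=
  [ffun i => \sum_j M i j * v j].

Definition actC n (M : 'M[R[i]]_n) (v : space (algC R) n) : space (algC R) n :=
  [ffun i => \sum_j M i j * v j].

Definition SO n : set (space (algR R) n -> space (algR R) n) :=
  @actR n @` [set M | M *m M^T = 1%:M /\ \det M = 1].

Definition SU n : set (space (algC R) n -> space (algC R) n) :=
  @actC n @` [set M | M \is unitarymx /\ \det M = 1].

Definition AutO : set (algO R -> algO R) :=
  [set f | [/\ linear f, bijective f &
               forall x y, f (amul x y) = amul (f x) (f y)]].

Definition G2 : set (space (algO R) 1 -> space (algO R) 1) :=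
  (fun f (v : space (algO R) 1) => [ffun i => f (v i)]) @` AutO.

End Lambda.

Arguments Sp R n : clear implicits.
Arguments HR R n : clear implicits.
Arguments HC R n : clear implicits.
Arguments HH R n : clear implicits.
Arguments HO R : clear implicits.
Arguments SO R n : clear implicits.
Arguments SU R n : clear implicits.
Arguments G2 R : clear implicits.

(* Main.v *)
(** The cases of R, C and H are linear algebra: a right-linear isometry is given
    by an orthogonal, resp. unitary, matrix, and over H the scalar [beta] of
    two right-linear maps related by [g v = alpha v beta] is a central unit.

    Over O, a twisted isomorphism fixing 1 equals its own twist, so it is an
    automorphism.  Conversely an automorphism f preserves the real quadratic
    equation of every octonion, hence the inner product; it remains to see that
    det f = 1.  Let e = (0, 1) and c = f e.  There is an imaginary p <> 0 with
    (y c) p = (y p) e for all y, so f followed by right multiplication R_p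
    commutes with the complex structure R_e and has nonnegative determinant.
    If p has norm r, then (R_(r + p))^2 = 2 r R_p, so det R_p > 0, and
    det f >= 0. *)


Require Import Defs.
From HB Require Import structures.
From mathcomp Require Import all_boot all_order all_algebra.
From mathcomp Require Import complex.
From mathcomp Require Import classical_sets reals.
From mathcomp Require Import boolp ring.
Import Defs.

Set Implicit Arguments.
Unset Strict Implicit.
Unset Printing Implicit Defensive.

Import Order.TTheory GRing.Theory Num.Theory.
Local Open Scope classical_set_scope.
Local Open Scope ring_scope.

(** * Linearity of plain, unbundled functions *)

Section LinearFunctions.
Variables (R : pzRingType) (U : lmodType R) (V : zmodType).
Variables (s : GRing.Scale.law R V) (f : U -> V).
Hypothesis linf : linear_for s f.

(** Twists and isometries are plain functions with a linearity hypothesis. Bundling them here makes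
    the library lemmas available, and the scaling law [s] covers maps to [A] and functionals to [R]
    alike. *)
Let F : {linear U -> V | s} := HB.pack f (GRing.isLinear.Build _ _ _ _ f linf).

Lemma lin0 : f 0 = 0. Proof. exact: (linear0 F). Qed.

Lemma linD : {morph f : u v / u + v}. Proof. exact: (linearD F). Qed.

Lemma linN : {morph f : u / - u}. Proof. exact: (linearN F). Qed.

Lemma linZ a u : f (a *: u) = s a (f u). Proof. exact: (linearZ_LR F). Qed.

Lemma lin_sum I (r : seq I) (u : I -> U) :
  f (\sum_(i <- r) u i) = \sum_(i <- r) f (u i).
Proof. exact: (linear_sum F). Qed.

End LinearFunctions.

Lemma linear_comp (R : realType) (U V W : lmodType R)
    (f : V -> W) (g : U -> V) :
  linear f -> linear g -> linear (f \o g).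
Proof. by move=> lf lg a u v /=; rewrite lg lf. Qed.

(** * Euclidean structure of the algebras *)

Record euclidean (R : realType) (A : alg R) : Prop := Euclidean {
  aip_linear : forall x : A, scalar (aip x);
  aipC : forall x y : A, aip x y = aip y x;
  abasis_sum : forall x : A, x = \sum_(b <- abasis A) aip b x *: b;
  abasis_orthonormal : forall i j, (i < size (abasis A))%N ->
    (j < size (abasis A))%N ->
    aip (nth 0 (abasis A) i) (nth 0 (abasis A) j) = (i == j)%:R }.

Lemma algR_euclidean (R : realType) : euclidean (algR R).
Proof.
split=> [x a y z|x y|x|[|i] [|j] //= _ _]; rewrite /aip /=.
- by rewrite -[_ *: _]/(_ * _); ring.
- exact: mulrC.
- by rewrite big_seq1 mul1r [LHS](esym (mulr1 x)).
- by rewrite mulr1.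
Qed.

Lemma algC_euclidean (R : realType) : euclidean (algC R).
Proof.
split=> [[x x'] a [y y'] [z z']|[x x'] [y y']|[x x']|i j].
- by rewrite /aip /=; ring.
- by rewrite /aip /=; ring.
- by rewrite /= big_cons big_seq1 /=; congr Complex => /=; ring.
by case: i => [|[|i]] //=; case: j => [|[|j]] //= _ _; ring.
Qed.

(** Carries the structure from [algC] to [algH] and on to [algO]: both copies of [A] embed linearly,
    and they are orthogonal to each other. *)
Lemma double_euclidean (R : realType) (A : alg R) :
  euclidean A -> euclidean (double A).
Proof.
move=> [lin sym sum orth].
have ip0 (x : A) : aip x 0 = 0 :> R := lin0 (lin x).
have ip0l (x : A) : aip 0 x = 0 :> R by rewrite sym ip0.
pose fst_in (x : A) : double A := (x, 0).
pose snd_in (x : A) : double A := (0, x).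
have lin1 : linear fst_in.
  by move=> a x y; congr (_, _); rewrite /= scaler0 addr0.
have lin2 : linear snd_in.
  by move=> a x y; congr (_, _); rewrite /= scaler0 addr0.
split=> [x a y z|x y|[x y]|i j] /=.
- by rewrite !lin mulrDr addrACA.
- by rewrite (sym x.1) (sym x.2).
- rewrite big_cat !big_map /=.
  transitivity (fst_in x + snd_in y).
    by congr (_, _); rewrite /= ?addr0 ?add0r.
  rewrite [in LHS](sum x) [in LHS](sum y) (lin_sum lin1) (lin_sum lin2).
  congr (_ + _); apply: eq_bigr => b _.
    by rewrite (linZ lin1) ip0l addr0.
  by rewrite (linZ lin2) ip0l add0r.
- rewrite size_cat !size_map !nth_cat !size_map.
  set m := size _ => ltim ltjm.
  have nth1 k : (k < m)%N ->
      nth 0 [seq (e, 0) | e <- abasis A] k = fst_in (nth 0 (abasis A) k).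
    exact: (nth_map 0).
  have nth2 k : (m <= k)%N -> (k < m + m)%N ->
      nth 0 [seq (0, e) | e <- abasis A] (k - m) =
      snd_in (nth 0 (abasis A) (k - m)).
    by move=> ? ?; rewrite (nth_map 0) // ltn_subLR.
  case: ltnP => im; case: ltnP => jm.
  + by rewrite !nth1 //= ip0 addr0 orth.
  + by rewrite nth1 // nth2 //= ip0 ip0l addr0 ltn_eqF // (leq_trans im).
  + by rewrite nth1 // nth2 //= ip0 ip0l addr0 gtn_eqF // (leq_trans jm).
  + rewrite !nth2 //= ip0 add0r orth ?ltn_subLR //.
    by rewrite -(eqn_add2r m) !subnK.
Qed.

(** * Orthonormal coordinates and matrices of endomorphisms *)

Section Coordinates.
Variables (R : realType) (A : alg R).
Hypothesis eA : euclidean A.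
Local Notation b i := (nth 0 (abasis A) i).
Implicit Types (f g : A -> A) (x y : A).

Lemma abasis_sum_ord x : x = \sum_(i < size (abasis A)) aip (b i) x *: b i.
Proof. by rewrite [LHS](abasis_sum eA) (big_nth 0) big_mkord. Qed.

Lemma aip_parseval x y :
  aip x y = \sum_(i < size (abasis A)) aip (b i) x * aip (b i) y.
Proof.
rewrite {1}(abasis_sum_ord y) (lin_sum (aip_linear eA x)).
by apply: eq_bigr => i _; rewrite (linZ (aip_linear eA x)) mulrC (aipC eA x).
Qed.

Lemma aip_eq0 x : aip x x = 0 -> x = 0.
Proof.
rewrite aip_parseval => /psumr_eq0P x0.
rewrite (abasis_sum_ord x) big1 // => i _.
have /eqP := x0 (fun i _ => sqr_ge0 _) i isT.
by rewrite mulf_eq0 orbb => /eqP ->; rewrite scale0r.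
Qed.

Lemma aip_ge0 x : 0 <= aip x x.
Proof. by rewrite aip_parseval sumr_ge0 // => i _; exact: sqr_ge0. Qed.

Lemma endo_mx_comp f g :
  linear f -> endo_mx (f \o g) = endo_mx f *m endo_mx g.
Proof.
move=> lf; apply/matrixP => i j; rewrite !mxE /=.
rewrite (abasis_sum_ord (g _)) (lin_sum lf) (lin_sum (aip_linear eA _)).
by apply: eq_bigr => k _; rewrite !mxE (linZ lf) (linZ (aip_linear eA _)) mulrC.
Qed.

Lemma endo_mx_scale a f : endo_mx (fun x => a *: f x) = a *: endo_mx f.
Proof.
by apply/matrixP => i j; rewrite !mxE (linZ (aip_linear eA _)).
Qed.

Lemma endo_mx_id : endo_mx id = 1%:M :> 'M_(size (abasis A)).
Proof. by apply/matrixP => i j; rewrite !mxE abasis_orthonormal. Qed.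

Lemma SOalg_id : SOalg (@id A).
Proof. by split; [split | rewrite endo_mx_id det1]. Qed.

Lemma endo_mx_isometry f :
  linear_isometry (@aip R A) f -> (endo_mx f)^T *m endo_mx f = 1%:M.
Proof.
move=> [_ isof]; apply/matrixP => i j; rewrite !mxE.
under eq_bigr do rewrite !mxE.
by rewrite -aip_parseval isof abasis_orthonormal.
Qed.

Lemma endo_mx_inj f g :
  linear f -> linear g -> endo_mx f = endo_mx g -> f =1 g.
Proof.
move=> lf lg eqfg x; rewrite (abasis_sum_ord x) (lin_sum lf) (lin_sum lg).
apply: eq_bigr => i _; rewrite (linZ lf) (linZ lg); congr (_ *: _).
rewrite (abasis_sum_ord (f _)) (abasis_sum_ord (g _)).
apply: eq_bigr => k _; congr (_ *: _).
by move/matrixP/(_ k i): eqfg; rewrite !mxE.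
Qed.

Lemma linear_bijective f : linear f -> endo_mx f \in unitmx -> bijective f.
Proof.
move=> lf uf; pose n := size (abasis A).
(* The map whose matrix is the inverse of that of [f]. Both composites then have the identity
   matrix, and [endo_mx_inj] turns them into identities. *)
pose g x :=
  \sum_(j < n) \sum_(k < n) (invmx (endo_mx f) j k * aip (b k) x) *: b j.
have lg : linear g.
  move=> a x y; rewrite /g scaler_sumr -big_split; apply: eq_bigr => j _ /=.
  rewrite scaler_sumr -big_split; apply: eq_bigr => k _ /=.
  by rewrite (aip_linear eA) mulrDr scalerDl scalerA mulrCA.
have mxg : endo_mx g = invmx (endo_mx f).
  apply/matrixP => i j; rewrite !mxE /g (lin_sum (aip_linear eA _)).
  rewrite (bigD1 i) //= (lin_sum (aip_linear eA _)) (bigD1 j) //=.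
  rewrite (linZ (aip_linear eA _)) !abasis_orthonormal // !eqxx.
  rewrite big1 => [|k kj]; last first.
    rewrite (linZ (aip_linear eA _)) (abasis_orthonormal eA (ltn_ord k)) //.
    by rewrite -val_eqE in kj; rewrite (negPf kj) mulr0; exact: mul0r.
  rewrite big1 => [|k ki]; last first.
    rewrite (lin_sum (aip_linear eA _)) big1 // => l _.
    rewrite (linZ (aip_linear eA _)) (abasis_orthonormal eA (ltn_ord i)) //.
    by rewrite -val_eqE eq_sym in ki; rewrite (negPf ki); exact: mulr0.
  by rewrite !addr0 mulr1; exact: mulr1.
exists g.
- apply: (@endo_mx_inj (g \o f) id) => //; first exact: linear_comp.
  by rewrite endo_mx_comp // mxg mulVmx // endo_mx_id.
- apply: (@endo_mx_inj (f \o g) id) => //; first exact: linear_comp.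
  by rewrite endo_mx_comp // mxg mulmxV // endo_mx_id.
Qed.

End Coordinates.

(** * Coordinate formulas for doubles and complex numbers *)

Section Doubling.
Variables (R : realType) (A : alg R).
Implicit Types x y u v : A.
Local Notation AA := (double A).

Lemma double_mulE x y u v : @amul R AA (x, y) (u, v) =
  (amul x u - amul (aconj v) y, amul v x + amul y (aconj u)).
Proof. by []. Qed.

Lemma double_addE x y u v : ((x, y) : AA) + (u, v) = (x + u, y + v).
Proof. by []. Qed.

Lemma double_oppE x y : - ((x, y) : AA) = (- x, - y).
Proof. by []. Qed.

Lemma double_scaleE a x y : a *: ((x, y) : AA) = (a *: x, a *: y).
Proof. by []. Qed.

Lemma double_conjE x y : @aconj R AA (x, y) = (aconj x, - y).
Proof. by []. Qed.

Lemma double_ipE x y u v : @aip R AA (x, y) (u, v) = aip x u + aip y v.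
Proof. by []. Qed.

Lemma double_oneE : @aone R AA = (aone, 0).
Proof. by []. Qed.

Lemma double_zeroE : (0 : AA) = (0, 0).
Proof. by []. Qed.

End Doubling.

Section ComplexAlgebra.
Variable R : realType.
Implicit Types a b c d : R.
Local Notation C := (algC R).

Lemma complex_mulE a b c d : @amul R C (Complex a b) (Complex c d) =
  Complex (a * c - b * d) (a * d + b * c).
Proof. by []. Qed.

Lemma complex_addE a b c d :
  (Complex a b : C) + (Complex c d) = Complex (a + c) (b + d).
Proof. by []. Qed.

Lemma complex_oppE a b : - (Complex a b : C) = Complex (- a) (- b).
Proof. by []. Qed.

Lemma complex_scaleE t a b : t *: (Complex a b : C) = Complex (t * a) (t * b).
Proof. by []. Qed.

Lemma complex_conjE a b : @aconj R C (Complex a b) = Complex a (- b).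
Proof. by []. Qed.

Lemma complex_ipE a b c d :
  @aip R C (Complex a b) (Complex c d) = a * c + b * d.
Proof. by []. Qed.

Lemma complex_oneE : @aone R C = Complex 1 0.
Proof. by []. Qed.

Lemma complex_zeroE : (0 : C) = Complex 0 0.
Proof. by []. Qed.

End ComplexAlgebra.

(* Rewriting with [algE] turns an identity between explicit quaternions or
   octonions into identities between their real coordinates. *)
Definition algE := (double_mulE, double_addE, double_oppE, double_scaleE,
  double_conjE, double_ipE, double_oneE, double_zeroE, complex_mulE,
  complex_addE, complex_oppE, complex_scaleE, complex_conjE, complex_ipE,
  complex_oneE, complex_zeroE).

(** * Right-linear maps and standard vectors *)

Section RightLinear.
Variables (R : realType) (A : alg R) (n : nat).
Hypothesis mul1 : forall x : A, amul aone x = x.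
Hypothesis mul0 : forall x : A, amul 0 x = 0.
Implicit Types (v w : space A n) (g : space A n -> space A n).

Lemma space_std_vec v : v = \sum_j rscale (std_vec A j) (v j).
Proof.
apply/ffunP => i; rewrite sum_ffunE (bigD1 i) //= !ffunE eqxx mul1.
rewrite big1 ?addr0 // => j ji.
by rewrite !ffunE eq_sym (negPf ji) mul0.
Qed.

Lemma right_linear_std_vec g : linear g ->
    (forall v x, g (rscale v x) = rscale (g v) x) ->
  forall v i, g v i = \sum_j amul (g (std_vec A j) i) (v j).
Proof.
move=> lg rg v i; rewrite [in LHS](space_std_vec v) (lin_sum lg) sum_ffunE.
by apply: eq_bigr => j _; rewrite rg ffunE.
Qed.

Lemma ip_std_vec (eA : euclidean A) (one1 : aip (aone : A) aone = 1)
    (i j : 'I_n) :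
  ip_space (std_vec A i) (std_vec A j) = (i == j)%:R :> R.
Proof.
have ip0 (x : A) : aip x 0 = 0 :> R := lin0 (aip_linear eA x).
rewrite /ip_space (bigD1 i) //= !ffunE eqxx big1 => [|k ki].
  by rewrite addr0 (fun_if (aip _)) one1 ip0; case: eqP.
by rewrite !ffunE (negPf ki) aipC.
Qed.

End RightLinear.

(** * The real case *)

Section Real.
Variables (R : realType) (n : nat).
Local Notation V := (space (algR R) n).
Implicit Types (v w : V) (M : 'M[R]_n).

Lemma ip_real_mx v w :
  ip_space v w = ((\col_i v i)^T *m (\col_i w i : 'cV[R]_n)) 0 0.
Proof. by rewrite !mxE; apply: eq_bigr => i _; rewrite !mxE. Qed.

Lemma col_actR M v : \col_i actR M v i = M *m (\col_i v i : 'cV[R]_n).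
Proof.
by apply/colP => i; rewrite !mxE ffunE; apply: eq_bigr => j _; rewrite !mxE.
Qed.

Lemma detR_actR M : detR (actR M) = \det M.
Proof.
congr (\det _); apply/matrixP => i j; rewrite mxE ffunE (bigD1 j) //=.
rewrite ffunE eqxx big1 => [|k kj]; first by rewrite addr0; exact: mulr1.
by rewrite ffunE (negPf kj); exact: mulr0.
Qed.

Lemma actR_linear M : linear (actR M).
Proof.
move=> a v w; apply/ffunP => i; rewrite !ffunE scaler_sumr -big_split /=.
apply: eq_bigr => j _; rewrite !ffunE mulrDr; congr (_ + _).
exact: (mulrCA (M i j : R) a (v j)).
Qed.

(** In dimension one the determinant of [theta] is the number [theta 1]. *)
Lemma SOalgR_id (theta : algR R -> algR R) : SOalg theta -> theta =1 id.
Proof.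
move=> [[lt _] det1] x; rewrite -[x in theta x](mulr1 (x : R)).
rewrite -[_ * _]/((x : R) *: (1 : R^o)) (linZ lt).
suff -> : theta 1 = 1 by exact: mulr1.
move: det1; rewrite /= (det_mx11 (endo_mx theta : 'M_1)) mxE => {}det1.
exact: etrans (esym (mul1r _)) det1.
Qed.

Lemma HR_eq_SO : HR R n = SO R n.
Proof.
apply/seteqP; split=> [g [[[lg isog] [theta /SOalgR_id id_theta rg]] detg]|].
  pose M : 'M[R]_n := \matrix_(i, j) g (std_vec (algR R) j) i.
  (* The columns of [M] are the images of the standard vectors, and [g] keeps these orthonormal. *)
  have MTM : M^T *m M = 1%:M.
    apply/matrixP => i j; rewrite !mxE.
    rewrite -(ip_std_vec (algR_euclidean R) (mulr1 1)) -isog.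
    by apply: eq_bigr => k _; rewrite !mxE.
  exists M; first by split;
    [exact: mulmx1C | rewrite -[RHS]detg /lambdaR /= mul1r].
  apply/funext => v; apply/ffunP => i; rewrite ffunE.
  have rlg w x : g (rscale w x) = rscale (g w) x by rewrite rg id_theta.
  rewrite (@right_linear_std_vec R (algR R) n (@mul1r R) (@mul0r R) g lg rlg).
  by apply: eq_bigr => j _; rewrite mxE.
move=> _ [M [MMT detM] <-].
split; last by rewrite /lambdaR detR_actR detM /= mulr1.
split; first split; first exact: actR_linear.
  move=> v w; rewrite !ip_real_mx !col_actR trmx_mul -mulmxA (mulmxA M^T).
  by rewrite (mulmx1C MMT) mul1mx.
exists id; first exact/SOalg_id/algR_euclidean.
move=> v x; apply/ffunP => i; rewrite !ffunE /amul /= mulr_suml.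
by apply: eq_bigr => j _; rewrite ffunE mulrA.
Qed.

End Real.

(** * The complex case *)

Lemma det_mx22 (R : comPzRingType) (A : 'M[R]_2) :
  \det A = A 0 0 * A 1 1 - A 0 1 * A 1 0.
Proof.
rewrite (expand_det_row _ 0) !big_ord_recl big_ord0 /cofactor !det_mx11 !mxE.
rewrite addr0 /= expr0 expr1 mul1r mulN1r mulrN.
by congr (A _ _ * A _ _ - A _ _ * A _ _); apply: val_inj.
Qed.

Section Complex.
Variables (R : realType) (n : nat).
Local Notation V := (space (algC R) n).
Implicit Types (v w : V) (M : 'M[R[i]]_n).
Local Open Scope sesquilinear_scope.

(** The Hermitian form, conjugate-linear in the first argument. Its real and imaginary parts are
    both real inner products, so a C-linear real isometry preserves it and is therefore unitary. *)
Definition herm v w : R[i] := \sum_i conjc (v i) * w i.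

Lemma Re_herm v w : complex.Re (herm v w) = ip_space v w.
Proof.
have ReD : {morph @complex.Re R : z t / z + t} by case=> ? ? [].
rewrite /herm (big_morph _ ReD (erefl : complex.Re (0 : R[i]) = 0)).
by apply: eq_bigr => i _; case: (v i) (w i) => [a b] [c d] /=; ring.
Qed.

Lemma Im_herm v w :
  complex.Im (herm v w) = ip_space (rscale v (Complex 0 1 : algC R)) w.
Proof.
have ImD : {morph @complex.Im R : z t / z + t} by case=> ? ? [].
rewrite /herm (big_morph _ ImD (erefl : complex.Im (0 : R[i]) = 0)).
apply: eq_bigr => i _; rewrite ffunE.
by case: (v i) (w i) => [a b] [c d] /=; ring.
Qed.

Lemma herm_mx v w :
  herm v w = ((\col_i v i : 'cV[R[i]]_n)^t* *m (\col_i w i)) 0 0.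
Proof. by rewrite !mxE; apply: eq_bigr => i _; rewrite !mxE. Qed.

Lemma col_actC M v : \col_i actC M v i = M *m (\col_i v i : 'cV[R[i]]_n).
Proof.
by apply/colP => i; rewrite !mxE ffunE; apply: eq_bigr => j _; rewrite !mxE.
Qed.

Lemma herm_actC M v w :
  M^t* *m M = 1%:M -> herm (actC M v) (actC M w) = herm v w.
Proof.
move=> MM; rewrite !herm_mx !col_actC trmx_mul map_mxM -mulmxA.
by rewrite (mulmxA (M ^t*)) MM mul1mx.
Qed.

Lemma detC_actC M : detC (actC M) = \det M.
Proof.
congr (\det _); apply/matrixP => i j; rewrite mxE ffunE (bigD1 j) //=.
rewrite ffunE eqxx big1 => [|k kj]; first by rewrite addr0; exact: mulr1.
by rewrite ffunE (negPf kj); exact: mulr0.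
Qed.

Lemma actC_linear M : linear (actC M).
Proof.
move=> a v w; apply/ffunP => i; rewrite !ffunE scaler_sumr -big_split /=.
apply: eq_bigr => j _; rewrite !ffunE mulrDr; congr (_ + _).
by case: (M i j) (v j) => [b c] [d e]; congr Complex => /=; ring.
Qed.

Lemma actC_rscale M v x : actC M (rscale v x) = rscale (actC M v) x.
Proof.
apply/ffunP => i; rewrite !ffunE /amul /= mulr_suml.
by apply: eq_bigr => j _; rewrite ffunE mulrA.
Qed.

(** Write [u + i w] for the image of [i]. As [theta] fixes 1, its determinant is [w], so [w = 1];
    preservation of the norm then forces [u = 0]. *)
Lemma SOalgC_id (theta : algC R -> algC R) :
  SOalg theta -> theta aone = aone -> theta =1 id.
Proof.
move=> [[lt iso_t] det1] t1 [a b].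
have -> : Complex a b =
    a *: (Complex 1 0 : algC R) + b *: (Complex 0 1 : algC R).
  by congr Complex => /=; ring.
rewrite lt (linZ lt) [theta _]t1; congr (_ + b *: _).
have := iso_t (Complex 0 1) (Complex 0 1).
move: det1; rewrite /= (det_mx22 (endo_mx theta : 'M_2)) !mxE /= t1.
case: (theta (Complex 0 1)) => u w /=.
have -> : (1 * 1 + 0 * 0) * (0 * u + 1 * w) -
    (1 * u + 0 * w) * (0 * 1 + 1 * 0) = w.
  by ring.
move=> -> uu; congr Complex; apply/eqP.
rewrite -(orbb (u == 0)) -mulf_eq0; apply/eqP/(addIr (1 * 1)).
by rewrite uu mulr0.
Qed.

End Complex.

Lemma HC_eq_SU (R : realType) (n : nat) : (0 < n)%N -> HC R n = SU R n.
Proof.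
move=> n_gt0; apply/seteqP; split=> [g [[[lg isog] [theta SOt rg]] detg]|].
  have bijg v : g v = 0 -> v = 0.
    move=> gv0; apply/ffunP => i; rewrite ffunE.
    have := isog v v; rewrite gv0 {1}/ip_space big1 => [|j _]; last first.
      by rewrite ffunE /aip /=; ring.
    move=> /esym/psumr_eq0P v0; apply: (aip_eq0 (algC_euclidean R)).
    by apply: v0 => // j _; exact/aip_ge0/algC_euclidean.
  (* For a standard vector [e], scaling by 1 gives [g e = (g e) (theta 1)]. Since [g] has trivial
     kernel, some coordinate of [g e] is nonzero and can be cancelled. *)
  have theta1 : theta aone = aone.
    pose e := std_vec (algC R) (Ordinal n_gt0).
    have e0 : e != 0.
      apply/eqP => /ffunP/(_ (Ordinal n_gt0)); rewrite !ffunE eqxx.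
      by move=> [/eqP]; rewrite oner_eq0.
    have [i gei] : exists i, g e i != 0.
      apply/existsP; apply: contra_neqT e0 => /existsPn ge0.
      by apply: bijg; apply/ffunP => i; rewrite ffunE; apply/eqP/negbNE/ge0.
    apply: (mulfI (gei : (g e i : R[i]) != 0)).
    have := rg e aone; have -> : rscale e aone = e.
      by apply/ffunP => j; rewrite ffunE; exact: mulr1.
    by move/ffunP/(_ i); rewrite !ffunE /amul /= => <-; exact/esym/mulr1.
  have id_theta := SOalgC_id SOt theta1.
  have rlg w x : g (rscale w x) = rscale (g w) x by rewrite rg id_theta.
  (* Commuting with multiplication by [i] carries the isometry property from the real part to the
     imaginary part. *)
  have hermg v w : herm (g v) (g w) = herm v w.
    apply/eqP; rewrite eq_complex !Re_herm !Im_herm -rlg !isog.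
    by rewrite !eqxx.
  pose M : 'M[R[i]]_n := \matrix_(i, j) (g (std_vec (algC R) j) i : R[i]).
  have MTM : (map_mx Num.conj M^T) *m M = 1%:M.
    apply/matrixP => i j; rewrite !mxE.
    transitivity (herm (g (std_vec (algC R) i)) (g (std_vec (algC R) j))).
      by apply: eq_bigr => k _; rewrite !mxE.
    rewrite hermg /herm (bigD1 i) //= !ffunE eqxx big1 => [|k ki].
      by rewrite addr0 conjc1 mul1r; case: eqP.
    by rewrite !ffunE (negPf ki) conjc0 mul0r.
  exists M; first by split; [exact/unitarymxP/mulmx1C|
                             rewrite -[RHS]detg /lambdaC /= mul1r].
  apply/funext => v; apply/ffunP => i; rewrite ffunE.
  rewrite (@right_linear_std_vec R (algC R) n (@mul1r _) (@mul0r _) g lg rlg).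
  by apply: eq_bigr => j _; rewrite mxE.
move=> _ [M [/unitarymxP MMT detM] <-].
split; last by rewrite /lambdaC detC_actC detM /=; exact: mulr1.
split; first split; first exact: actC_linear.
  by move=> v w; rewrite -!Re_herm herm_actC //; exact: mulmx1C.
exists id; first exact/SOalg_id/algC_euclidean.
by move=> v x; exact: actC_rscale.
Qed.

(** * The quaternionic case *)

Section Quaternions.
Variable R : realType.
Local Notation H := (algH R).

Ltac quaternion_ring := repeat intro; repeat match goal with
    z : GRing.Lmodule.sort _ |- _ => destruct z as [[? ?] [? ?]] end;
  rewrite !algE; congr (Complex _ _, Complex _ _); ring.

Lemma quat_mulA : associative (@amul R H).
Proof. quaternion_ring. Qed.

Lemma quat_mul1 : left_id aone (@amul R H).
Proof. quaternion_ring. Qed.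

Lemma quat_mulr1 : right_id aone (@amul R H).
Proof. quaternion_ring. Qed.

Lemma quat_mulN (x y : H) : amul (- x) y = - amul x y.
Proof. quaternion_ring. Qed.

Lemma quat_mulrN (x y : H) : amul x (- y) = - amul x y.
Proof. quaternion_ring. Qed.

Lemma quat_mulrB (x y z : H) : amul x (y - z) = amul x y - amul x z.
Proof. quaternion_ring. Qed.

(** Euler's four-square identity; it rules out zero divisors. *)
Lemma quat_normM (x y : H) :
  aip (amul x y) (amul x y) = aip x x * aip y y :> R.
Proof.
case: x y => [[a b] [c d]] [[a' b'] [c' d']].
by rewrite !algE; ring.
Qed.

Lemma algH_euclidean : euclidean H.
Proof. exact/double_euclidean/algC_euclidean. Qed.

Lemma quat_mul_eq0 (x y : H) : amul x y = 0 -> x != 0 -> y = 0.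
Proof.
move=> xy0 x0; apply: (aip_eq0 algH_euclidean).
apply: (mulfI (x := aip x x)).
  by apply: contra_neq x0; exact: aip_eq0 algH_euclidean _.
by rewrite -quat_normM xy0 mulr0; exact: lin0 (aip_linear algH_euclidean _).
Qed.

(** Commuting with [j] kills the [i] and [k] coordinates, and commuting with [i] kills the [j]
    coordinate. So [y] is real, of square 1. *)
Lemma quat_central_unit (y : H) : aip y y = 1 ->
  (forall x, amul x y = amul y x) -> y = aone \/ y = - aone.
Proof.
case: y => [[a b] [c d]] y1 yc.
have := yc (Complex 0 1, 0); have := yc (0, Complex 1 0); move: y1.
have self_opp (z : R) : - z = z -> z = 0.
  move=> zz; apply/eqP; rewrite -(orFb (z == 0)) -(mulrn_eq0 z 2).
  by rewrite mulr2n -{1}zz addNr.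
rewrite !algE !(mul0r, mulr0, mul1r, mulr1, oppr0, add0r, addr0) => y1.
rewrite !(mulrN1, mulN1r, sub0r, subr0, addr0, opprK).
move=> -[/esym/self_opp d0 /self_opp b0] [_ /esym/self_opp c0].
have /eqP : a ^+ 2 = 1 by rewrite -y1 b0 c0 d0; ring.
rewrite b0 c0 d0 sqrf_eq1 => /orP[] /eqP ->; by [left|right].
Qed.

End Quaternions.

Section Symplectic.
Variables (R : realType) (n : nat).
Local Notation H := (algH R).
Implicit Types (v w : space H n) (x y : H).

Lemma quat_rscaleA v x y : rscale (rscale v x) y = rscale v (amul x y).
Proof. by apply/ffunP => i; rewrite !ffunE quat_mulA. Qed.

Lemma quat_rscale1 v : rscale v aone = v.
Proof. by apply/ffunP => i; rewrite ffunE quat_mulr1. Qed.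

Lemma quat_rscaleN v x : rscale v (- x) = - rscale v x.
Proof. by apply/ffunP => i; rewrite !ffunE quat_mulrN. Qed.

Lemma quat_rscaleNl v x : rscale (- v) x = - rscale v x.
Proof. by apply/ffunP => i; rewrite !ffunE quat_mulN. Qed.

Lemma ip_spaceNN v w : ip_space (- v) (- w) = ip_space v w.
Proof.
have eH := algH_euclidean R.
apply: eq_bigr => i _; rewrite !ffunE (linN (aip_linear eH _)) aipC //.
by rewrite (linN (aip_linear eH _)) opprK aipC.
Qed.

(** Supplies the pair [(- g, - aone)], which represents the same map as [(g, aone)] and accounts for
    the second element of [sign_class aone]. *)
Lemma SpN (a : space H n -> space H n) : Sp R n a -> Sp R n (fun v => - a v).
Proof.
move=> [[la isoa] ra]; split; first split.
- by move=> c v w; rewrite la opprD scalerN.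
- by move=> v w; rewrite ip_spaceNN isoa.
- by move=> v x; rewrite ra quat_rscaleNl.
Qed.

(* If [g] and [alpha] both commute with right multiplications and
   [g v = alpha v beta], then [beta] is central. *)
Lemma Sp_represents g alpha (beta : H) : (0 < n)%N ->
  Sp R n g -> represents alpha beta g -> beta = aone \/ beta = - aone.
Proof.
move=> n_gt0 [_ rg] [[[_ isoa] ra] beta1 galpha].
apply: quat_central_unit => // x; apply/eqP; rewrite -subr_eq0; apply/eqP.
pose e := std_vec H (Ordinal n_gt0).
have e1 : ip_space e e = 1.
  rewrite (ip_std_vec (algH_euclidean R)) ?eqxx // !algE; ring.
(* Right-linearity of [g] and [alpha] gives [alpha e (x beta - beta x) = 0]; a nonzero coordinate of
   [alpha e] can be cancelled. *)
have [i aei] : exists i, alpha e i != 0.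
  apply/existsP; apply/existsPn => a0; move: e1; rewrite -isoa.
  rewrite /ip_space big1 => [/eqP|i _]; first by rewrite eq_sym oner_eq0.
  rewrite (eqP (negbNE (a0 i))).
  exact: lin0 (aip_linear (algH_euclidean R) _).
apply: (quat_mul_eq0 _ aei); rewrite quat_mulrB.
have := rg e x; rewrite !galpha ra !quat_rscaleA => /ffunP/(_ i).
by rewrite !ffunE => ->; exact: subrr.
Qed.

Lemma HH_eq_Sp : (0 < n)%N -> HH R n = Sp R n.
Proof.
move=> n_gt0; apply/seteqP; split=> [g [_ lambda_g]|g Sp_g].
  (* The value at [aone] is the set of all possible [beta]. As it contains [aone], some pair with
     [beta = aone] represents [g]. *)
  have : lambdaH g aone aone by rewrite lambda_g; left.
  move=> [alpha [beta [[Sp_alpha _ galpha]]]]; rewrite quat_mul1 => beta1.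
  suff -> : g = alpha by [].
  by apply/funext => v; rewrite galpha -beta1 quat_rscale1.
have [iso_g rg] := Sp_g; split.
  by split=> //; exists id => //; exact/SOalg_id/algH_euclidean.
have one1 : aip (aone : H) aone = 1.
  by rewrite !algE; ring.
apply/seteqP; split=> [y [alpha [beta [g_rep ->]]]|_ [|] ->].
- rewrite quat_mul1.
  by case: (Sp_represents n_gt0 Sp_g g_rep) => ->; [left|right].
- exists g, aone; rewrite quat_mul1; split=> //; split=> // v.
  by rewrite quat_rscale1.
- exists (fun v => - g v), (- aone); rewrite quat_mul1; split=> //; split.
  + exact: SpN.
  + by rewrite !algE; ring.
  + by move=> v; rewrite quat_rscaleN quat_rscaleNl opprK quat_rscale1.
Qed.

End Symplectic.

(** * The octonionic case: signs of determinants *)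

Lemma det_complex_structure_ge0 (R : rcfType) (n : nat) (X Y : 'M[R]_n) :
  0 <= \det (block_mx X (- Y) Y X).
Proof.
pose toC := map_mx (real_complex R).
pose Z := toC _ _ X + 'i%C *: toC _ _ Y.
(* The block matrix is the real form of [Z = X + i Y]. The unipotent factors [P] and [Q] make it
   block triangular with diagonal blocks [Z] and its conjugate, so its determinant is the squared
   modulus of [\det Z]. *)
pose P : 'M[R[i]]_(n + n) := block_mx 1%:M 'i%C%:M 0 1%:M.
pose Q : 'M[R[i]]_(n + n) := block_mx 1%:M (- 'i%C)%:M 0 1%:M.
have PBQ : P *m toC _ _ (block_mx X (- Y) Y X) *m Q =
    block_mx Z 0 (toC _ _ Y) (map_mx conjc Z).
  rewrite /toC map_block_mx !mulmx_block !(mul1mx, mulmx1, mul0mx, mulmx0).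
  rewrite !(add0r, addr0) !mul_scalar_mx !mul_mx_scalar.
  by congr block_mx; apply/matrixP => i j; rewrite !mxE;
    congr Complex => /=; ring.
have detPQ : \det P = 1 /\ \det Q = 1 by rewrite /P /Q !det_ublock !det1 mulr1.
rewrite -ler0c -[_%:C%C]det_map_mx.
have := congr1 determinant PBQ.
rewrite !det_mulmx (proj1 detPQ) (proj2 detPQ) mul1r mulr1 => ->.
rewrite det_lblock det_map_mx.
by rewrite -normCK exprn_ge0.
Qed.

Section Octonions.
Variable R : realType.
Local Notation O := (algO R).
Local Notation oct_unit := ((0, aone) : O).
Implicit Types (x y p c : O) (f : O -> O).

Ltac octonion_ring := repeat intro; repeat match goal with
    z : GRing.Lmodule.sort _ |- _ => destruct z as [[[? ?] [? ?]] [[? ?] [? ?]]]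
  end; rewrite !algE;
  congr ((Complex _ _, Complex _ _), (Complex _ _, Complex _ _)); ring.

Lemma oct_mul1 : left_id aone (@amul R O).
Proof. octonion_ring. Qed.

Lemma oct_mulr1 : right_id aone (@amul R O).
Proof. octonion_ring. Qed.

Lemma oct_mulDr x y p : amul x (y + p) = amul x y + amul x p.
Proof. octonion_ring. Qed.

Lemma oct_mulZr a x y : amul x (a *: y) = a *: amul x y.
Proof. octonion_ring. Qed.

Lemma oct_mul_linear p : linear (fun x => amul x p).
Proof.
suff mulDZ a x y : amul (a *: x + y) p = a *: amul x p + amul y p.
  exact: mulDZ.
octonion_ring.
Qed.

(** The substitute for associativity: [R_p] composed with itself is right multiplication by
    [p p]. *)
Lemma oct_right_alternative x p : amul (amul x p) p = amul x (amul p p).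
Proof. octonion_ring. Qed.

(** The characteristic equation, with trace [2 * aip aone x] and norm [aip x x]. It expresses the
    inner product through the multiplication. *)
Lemma oct_quadratic x :
  amul x x = (2 * aip aone x) *: x - aip x x *: aone.
Proof. octonion_ring. Qed.

(** On the two copies of [algH], right multiplication by [oct_unit] is the standard complex
    structure. *)
Lemma oct_mul_unit (u v : algH R) : amul ((u, v) : O) oct_unit = (- v, u).
Proof.
case: u v => [[a b] [c d]] [[a' b'] [c' d']]; octonion_ring.
Qed.

Lemma oct_unit_sqr : amul oct_unit oct_unit = - aone :> O.
Proof. by rewrite oct_mul_unit -[in LHS]oppr0. Qed.

Lemma algO_euclidean : euclidean O.
Proof. exact/double_euclidean/algH_euclidean. Qed.
Local Notation eO := algO_euclidean.

Lemma det_right_unit_commuting_ge0 f : linear f ->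
    (forall x, f (amul x oct_unit) = amul (f x) oct_unit) ->
  0 <= \det (endo_mx f).
Proof.
move=> lf fe.
pose h i : algH R := nth 0 (abasis (algH R)) i.
pose X : 'M[R]_4 := \matrix_(i, j) aip (h i) (f (h j, 0)).1.
pose Y : 'M[R]_4 := \matrix_(i, j) aip (h i) (f (h j, 0)).2.
suff -> : (endo_mx f : 'M_(4 + 4)) = block_mx X (- Y) Y X.
  exact: (det_complex_structure_ge0 X Y).
have eH := algH_euclidean R.
have nth_l (i : 'I_4) : nth 0 (abasis O) (lshift 4 i) = (h i, 0).
  by case: i => [[|[|[|[|k]]]] k_lt4].
have nth_r (i : 'I_4) : nth 0 (abasis O) (rshift 4 i) = (0, h i).
  by case: i => [[|[|[|[|k]]]] k_lt4].
(* Since [(0, h j)] is [(h j, 0)] times [oct_unit], the first four columns determine the last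
   four. *)
have f_r j : f (0, h j) = (- (f (h j, 0)).2, (f (h j, 0)).1).
  have := fe (h j, 0); rewrite oct_mul_unit oppr0 => ->.
  by case: (f _) => u v; exact: oct_mul_unit.
have ip0 (z : algH R) : aip 0 z = 0.
  by rewrite (aipC eH); exact: lin0 (aip_linear eH z).
apply/matrixP => i j.
rewrite -(splitK i) -(splitK j); case: (split i) (split j) => [k|k] [l|l] /=.
- rewrite block_mxEul !mxE !nth_l; case: (f _) => u v.
  by rewrite double_ipE ip0 addr0.
- rewrite block_mxEur !mxE nth_l nth_r f_r double_ipE ip0 addr0.
  by rewrite (linN (aip_linear eH _)).
- rewrite block_mxEdl !mxE nth_l nth_r; case: (f _) => u v.
  by rewrite double_ipE ip0 add0r.
- by rewrite block_mxEdr !mxE !nth_r f_r double_ipE ip0 add0r.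
Qed.

Lemma det_right_mul_gt0 p r : 0 < r -> amul p p = - (r ^+ 2) *: aone ->
  0 < \det (endo_mx (fun x => amul x p)).
Proof.
move=> r_gt0 pp.
pose d f := \det (endo_mx f); pose N := size (abasis O).
have d_scale a f : d (fun x => a *: f x) = a ^+ N * d f.
  by rewrite /d (endo_mx_scale eO) detZ.
have d_sqr q :
    d (fun x => amul x (amul q q)) = d (fun x => amul x q) ^+ 2.
  rewrite expr2 -det_mulmx -(endo_mx_comp eO _ (oct_mul_linear q)).
  by congr d; apply/funext => x; exact/esym/oct_right_alternative.
pose s : O := r *: aone + p.
have ss : amul s s = (2 * r) *: p.
  rewrite /s oct_mul_linear oct_mul1 oct_mulDr oct_mulZr oct_mulr1 pp.
  rewrite scalerDr scalerA -expr2 scaleNr [r *: p + - _]addrC addrACA.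
  by rewrite subrr add0r -scalerDl mulr_natl mulr2n.
have d_s : d (fun x => amul x s) ^+ 2 = (2 * r) ^+ N * d (fun x => amul x p).
  rewrite -d_sqr ss -d_scale; congr d.
  by apply/funext => x; rewrite oct_mulZr.
(* The equation [d_s] only makes the determinant of [R_p] nonnegative; this one makes it nonzero. *)
have d_p : d (fun x => amul x p) ^+ 2 = (- (r ^+ 2)) ^+ N.
  have d_id : d id = 1 by rewrite /d (endo_mx_id eO) det1.
  rewrite -d_sqr pp -[RHS]mulr1 -d_id -d_scale; congr d.
  by apply/funext => x; rewrite oct_mulZr oct_mulr1.
rewrite -/(d _); move: N d_s d_p {d_scale d_sqr}.
move: (d _) (d _) => ds dp N d_s d_p.
have rN_gt0 : 0 < (2 * r) ^+ N by rewrite exprn_gt0 // mulr_gt0.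
rewrite lt_def -(pmulr_rge0 _ rN_gt0) -d_s sqr_ge0 andbT -sqrf_eq0 d_p.
by rewrite expf_neq0 // oppr_eq0 expf_neq0 // gt_eqF.
Qed.

(* For [c != - oct_unit] take [p = c + oct_unit]: by right alternativity
   [(y c) p = - y + (y c) oct_unit = (y p) oct_unit]. *)
Lemma oct_unit_conjugate c : aip aone c = 0 -> amul c c = - aone ->
  exists p r, [/\ 0 < r, amul p p = - (r ^+ 2) *: aone &
    forall y, amul (amul y c) p = amul (amul y p) oct_unit].
Proof.
move=> c1 cc.
have mulN1 y : amul y (- aone) = - y.
  by rewrite -scaleN1r oct_mulZr oct_mulr1 scaleN1r.
have [->|cu] := eqVneq c (- oct_unit).
  (* Here [c + oct_unit] vanishes. The quaternion [i] works instead: it is an imaginary unit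
     orthogonal to [oct_unit], so the two right multiplications anticommute. *)
  exists ((Complex 0 1, 0), 0), 1; split=> //.
    by octonion_ring.
  octonion_ring.
have p1 : aip aone (c + oct_unit) = 0.
  rewrite (linD (aip_linear eO _)) c1 add0r !algE; ring.
(* Here [r] is the norm of [p]: for imaginary [p] the characteristic equation reads
   [p p = - r^2]. *)
exists (c + oct_unit), (Num.sqrt (aip (c + oct_unit) (c + oct_unit))); split.
- rewrite sqrtr_gt0 lt_def aip_ge0 ?andbT; last exact: eO.
  by apply: contra_neq cu => /(aip_eq0 eO)/eqP; rewrite addr_eq0 => /eqP.
- rewrite sqr_sqrtr; last exact: aip_ge0 eO _.
  by rewrite [LHS]oct_quadratic p1 mulr0 scale0r add0r scaleNr.
move=> y; rewrite !oct_mulDr (linD (oct_mul_linear _)) oct_right_alternative cc.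
by rewrite oct_right_alternative oct_unit_sqr mulN1 addrC.
Qed.

(** * Automorphisms of the octonions are rotations *)

Section Automorphisms.
Variable f : O -> O.
Hypothesis Aut_f : AutO f.

Let lf : linear f. Proof. by case: Aut_f. Qed.
Let bij_f : bijective f. Proof. by case: Aut_f. Qed.
Let mf x y : f (amul x y) = amul (f x) (f y). Proof. by case: Aut_f. Qed.

Lemma AutO_one : f aone = aone.
Proof.
case: bij_f => g fK gK.
by rewrite -[LHS]oct_mulr1 -[X in amul _ X]gK -mf oct_mul1 gK.
Qed.

(* [x] and [f x] are roots of the same real quadratic polynomial. *)
Lemma AutO_quadratic x :
  aip aone (f x) = aip aone x /\ aip (f x) (f x) = aip x x.
Proof.
have sub_swap (a b c d : O) : a - b = c - d -> a - c = b - d.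
  move=> abcd; rewrite -[a](subrK b) abcd.
  by rewrite [LHS]addrC !addrA addNr add0r addrC.
have := oct_quadratic (f x); rewrite -mf oct_quadratic.
rewrite (linD lf) (linN lf) !(linZ lf) AutO_one => /sub_swap.
rewrite -!scalerBl -mulrBr; set t := _ - _; set d := _ - _ => td.
(* If the traces differed, the difference of the two quadratic equations would make [f x] a real
   multiple of [aone]. Then [f] would fix [f x], and injectivity would give [f x = x], a
   contradiction. *)
have t0 : t = 0.
  apply/eqP; apply/negPn/negP => t_neq0.
  suff fx : f x = x by move: t_neq0; rewrite /t fx subrr eqxx.
  have t2 : 2 * t != 0 by rewrite mulf_neq0 ?pnatr_eq0.
  have fxE : f x = ((2 * t)^-1 * d) *: aone.
    by rewrite -scalerA -td scalerA mulVf // scale1r.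
  apply: (bij_inj bij_f); rewrite [in LHS]fxE.
  by rewrite (linZ lf) AutO_one; exact/esym/fxE.
have one_neq0 : aone != 0 :> O.
  by apply/eqP => [[/eqP]]; rewrite oner_eq0.
have := td; rewrite t0 mulr0 scale0r => /esym/eqP; rewrite scaler_eq0.
rewrite (negPf one_neq0) orbF subr_eq0 => /eqP ->.
by split=> //; apply/esym/eqP; rewrite -subr_eq0 -/t t0.
Qed.

(** Polarization of the norm, which [AutO_quadratic] shows to be preserved. *)
Lemma AutO_isometry : linear_isometry (@aip R O) f.
Proof.
split=> // x y; have [_] := AutO_quadratic (x + y).
have ipD (u v : O) :
    aip (u + v) (u + v) = aip u u + aip v v + aip u v *+ 2.
  rewrite (linD (aip_linear eO _)) !(aipC eO (u + v)).
  rewrite !(linD (aip_linear eO _)) (aipC eO v u) mulr2n.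
  by rewrite addrACA [in RHS]addrACA [aip u v + _ in LHS]addrC.
rewrite (linD lf) !ipD (proj2 (AutO_quadratic x)) (proj2 (AutO_quadratic y)).
by move=> /addrI/eqP; rewrite eqr_pMn2r // => /eqP.
Qed.

Lemma AutO_det : \det (endo_mx f) = 1.
Proof.
(* An isometry has determinant 1 or -1; the remaining steps exclude -1. *)
have det2 : \det (endo_mx f) ^+ 2 = 1.
  rewrite expr2 -[in X in X * _]det_tr -det_mulmx.
  by rewrite (endo_mx_isometry eO AutO_isometry) det1.
have u1 : aip aone (oct_unit : O) = 0 by rewrite !algE; ring.
have [] := @oct_unit_conjugate (f oct_unit).
- by rewrite (proj1 (AutO_quadratic _)).
- by rewrite -mf oct_unit_sqr (linN lf) AutO_one.
move=> p [r [r_gt0 pp yp]].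
have /det_right_unit_commuting_ge0 : linear ((fun x => amul x p) \o f).
  exact: linear_comp (oct_mul_linear p) lf.
rewrite (endo_mx_comp eO _ (oct_mul_linear p)) det_mulmx.
rewrite pmulr_rge0 ?(det_right_mul_gt0 r_gt0) // => det_ge0.
have {}det_ge0 : 0 <= \det (endo_mx f).
  by apply: det_ge0 => x; rewrite [LHS]/comp mf yp.
move/eqP: det2; rewrite sqrf_eq1 => /orP[/eqP //|/eqP det_N1].
by move: det_ge0; rewrite det_N1 oppr_ge0 ler10.
Qed.

End Automorphisms.

Lemma HO_eq_G2 : HO R = G2 R.
Proof.
apply/seteqP; split=> [g [[[lg _] [theta SOt rg]] g1]|_ [f Aut_f <-]].
  pose f x : O := g [ffun=> x] ord0.
  have fM x y : f (amul x y) = amul (f x) (theta y).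
    have := rg [ffun=> x] y => /ffunP/(_ ord0); rewrite ffunE => <-.
    by congr (g _ ord0); apply/ffunP => i; rewrite !ffunE.
  (* Put [aone] as the vector in the twist identity [fM], where [f aone = aone]. *)
  have f_theta : f = theta.
    by apply/funext => x; rewrite -[x in f x]oct_mul1 fM [f aone]g1 oct_mul1.
  have [[lt iso_t] det_t] := SOt.
  exists theta.
    split=> //; last by move=> x y; rewrite -{1}f_theta fM f_theta.
    apply: linear_bijective => //; first exact: eO.
    by rewrite unitmxE det_t unitr1.
  apply/funext => v; apply/ffunP => i; rewrite ffunE -f_theta /f ord1.
  by congr (g _ _); apply/ffunP => j; rewrite ffunE ord1.
have iso_f := AutO_isometry Aut_f; have [lf _ mf] := Aut_f.
split; last by rewrite /lambdaO !ffunE (AutO_one Aut_f).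
split; first split.
- by move=> a v w; apply/ffunP => i; rewrite !ffunE lf.
- move=> v w; apply: eq_bigr => i _; rewrite !ffunE; exact: (proj2 iso_f).
exists f; first by split=> //; exact: AutO_det.
by move=> v x; apply/ffunP => i; rewrite !ffunE mf.
Qed.

End Octonions.

Theorem lemma7 (R : realType) :
  (forall n : nat, (0 < n)%N -> HR R n = SO R n) /\
  (forall n : nat, (0 < n)%N -> HC R n = SU R n) /\
  (forall n : nat, (0 < n)%N -> HH R n = Sp R n) /\
  HO R = G2 R.
Proof.
split; first by move=> n _; exact: HR_eq_SO.
split; first by move=> n; exact: HC_eq_SU.
split; first by move=> n; exact: HH_eq_Sp.
exact: HO_eq_G2.
Qed.
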